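(* Let $F:\mathcal{E}\to\mathcal{E}$ be an $\alpha$-passive causal function, let $N\in\mathbb{N}$, $N\geqslant 1$, and let $e\in\mathcal{E}\subset\mathcal{L}^{I}$ (the exciting function) have support in $[0,N\tau)\subset I$. Suppose $g\in\mathcal{L}^{I}$ is a process such that $g(t)\equiv 0$ for $t\leqslant 0$ and, recursively for $t=n\tau$, $n\in\mathbb{N}=\{0,1,2,\dots\}$, $$g(t+\tau)=F[e+g](t).$$ Then $g$ is uniquely defined (modulo $\mu$), and for every $t\geqslant N\tau$ $$\|g(t)\|\;\leqslant\; a+\Big(\frac{b}{\tau}\int_{[0,N\tau)}\big(\alpha(e+g)-\alpha(g)\big)\,d\mu\Big)^{c}$$ for all non-negative real constants $a,b,c$ which satisfy $\|z\|\leqslant a+b\,(\alpha(z))^{c}$ for every $z\in\mathcal{L}$. Hence $g$ is stable.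
   Context: $(\mathcal{L},\|\cdot\|)$ is a real or complex normed linear space. $\tau>0$ is a real number. Either $I=\mathbb{R}$ with the measure $\mu$ concentrated on $\{k\tau\mid k\in\mathbb{Z}\}$ with uniform weight $\mu(\{k\tau\})=\tau$, or $I=\{k\tau\mid k\in\mathbb{Z}\}$ with the same measure $\mu$. Functions on $I$ are read modulo $\mu$, i.e. as equivalence classes of functions that differ at most on sets of $\mu$-measure zero (so only the values at the points $k\tau$ matter). Intervals are intervals of $I$. $\chi_{P}(s)$ denotes the characteristic function of a property $P$ ($1$ if $s$ has the property, $0$ otherwise). $\alpha:\mathcal{L}\to\mathbb{R}$ is a continuous non-negative functional that is a (de)limiting functional: there exist non-negative real constants $a,b,c$ such that $\|z\|\leqslant a+b(\alpha(z))^{c}$ for every $z\in\mathcal{L}$. $\mathcal{E}\subset\mathcal{L}^{I}$ is a set of functions such that: (1) for every $f\in\mathcal{E}$ and $t\in I$ the function $s\mapsto\chi_{s\leqslant t}(s)f(s)$ is in $\mathcal{E}$; (2) for every $f\in\mathcal{E}$ the function $t\mapsto f(t-\tau)$ is in $\mathcal{E}$; (3) $\alpha\circ f$ is $\mu$-summable over finite intervals of $I$ for every $f\in\mathcal{E}$. $\mathcal{E}$ is not assumed to be a linear space. A function $F:\mathcal{E}\to\mathcal{E}$ is causal iff for every $f\in\mathcal{E}$ and $t\in I$, $Ff(t)=F[\chi_{s\leqslant t}f(s)](t)$. A causal function $F:\mathcal{E}\to\mathcal{E}$ is $\alpha$-passive iff for every $f\in\mathcal{E}$ and $t\in I$, $$\int_{s<t}\alpha(Ff(s))\,d\mu(s)\leqslant\int_{s<t}\alpha(f(s))\,d\mu(s).$$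 A process $g:I\to\mathcal{L}$ is stable iff it is uniformly bounded on $I$, i.e. there is $b\in\mathbb{R}_{+}$ with $\|g(t)\|<b$ for every $t\in I$. In the recursion, $F[e+g](t)$ depends, by causality, only on the values of $e+g$ up to time $t$, and it is understood as $F[\chi_{s\leqslant t}(e+g)](t)$; that the recursion holds presupposes that these truncated functions belong to $\mathcal{E}$. Existence of $g$ is not asserted.
   Formalization: The bound is proved as a + b((1/τ)∫(α(e+g)−α(g))dμ)^c, with b outside the power, since the printed form fails; and α(0)=0 is assumed, since otherwise passivity reads ∞ ≤ ∞ for signals vanishing in the past and the bound fails. *)

(* Defs.v *)
From HB Require Import structures.
From mathcomp Require Import all_boot all_order all_algebra.
From mathcomp Require Import complex.
From mathcomp Require Import all_classical all_reals all_analysis.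

Set Implicit Arguments.
Unset Strict Implicit.
Unset Printing Implicit Defensive.

Import Order.TTheory GRing.Theory Num.Theory.
Import numFieldNormedType.Exports.

Local Open Scope classical_set_scope.
Local Open Scope ring_scope.

Inductive time_axis := continuous_time | discrete_time.

Definition grid (R : realType) (tau : {posnum R}) : set R :=
  range (fun k : int => k%:~R * tau%:num).

Definition time_set (R : realType) (ax : time_axis) (tau : {posnum R}) : set R :=
  match ax with continuous_time => setT | discrete_time => grid tau end.

Definition time (R : realType) (ax : time_axis) (tau : {posnum R}) : Type :=
  set_type (time_set ax tau).

Definition time_val (R : realType) (ax : time_axis) (tau : {posnum R})
  (t : time ax tau) : R := sval t.
Coercion time_val : time >-> Real.sort.

HB.instance Definition _ (R : realType) ax (tau : {posnum R}) :=
  Choice.copy (time ax tau) (set_type (time_set ax tau)).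

Lemma time_set_grid (R : realType) ax (tau : {posnum R}) :
  grid tau `<=` time_set ax tau.
Proof. by case: ax. Qed.

Lemma time_setB (R : realType) ax (tau : {posnum R}) (t : R) :
  time_set ax tau t -> time_set ax tau (t - tau%:num).
Proof.
case: ax => //= -[k _ <-].
by exists (k - 1) => //; rewrite intrB mulrBl mul1r.
Qed.

Definition tick (R : realType) ax (tau : {posnum R}) (k : int) : time ax tau :=
  exist _ (k%:~R * tau%:num)
    (mem_set (@time_set_grid R ax tau _ (imageP _ (a := k) I))).

HB.instance Definition _ (R : realType) ax (tau : {posnum R}) :=
  isPointed.Build (time ax tau) (tick ax tau 0).

(* The sigma-algebra is the full power set: it is the completion of the Borel
   sets for mu, so that every function on the time axis is measurable. *)
HB.instance Definition _ (R : realType) ax (tau : {posnum R}) :=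
  @isMeasurable.Build default_measure_display (time ax tau)
    discrete_measurable discrete_measurable0
    discrete_measurableC discrete_measurableU.

Definition back (R : realType) ax (tau : {posnum R}) (t : time ax tau) :
    time ax tau :=
  exist _ ((t : R) - tau%:num) (mem_set (time_setB (set_mem (svalP t)))).

Definition ticks (R : realType) ax (tau : {posnum R}) : set (time ax tau) :=
  range (@tick R ax tau).

Lemma measurable_ticks (R : realType) ax (tau : {posnum R}) :
  measurable (@ticks R ax tau).
Proof. by []. Qed.

(* mass tau at each k * tau, and no other mass *)
Definition mu (R : realType) ax (tau : {posnum R}) :
    {measure set (time ax tau) -> \bar R} :=
  mscale tau%:num%:nng (mrestr counting (@measurable_ticks R ax tau)).

Inductive scalar_kind := real_scalars | complex_scalars.

Definition scalars (R : realType) (s : scalar_kind) : numFieldType :=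
  match s with real_scalars => R | complex_scalars => R[i] end.

(* Over R[i] the norm `|z| is a complex number with zero imaginary part. *)
Definition real_norm (R : realType) (s : scalar_kind)
    (L : normedModType (scalars R s)) (z : L) : R :=
  match s return scalars R s -> R with
  | real_scalars => fun x => x
  | complex_scalars => fun x => complex.Re x
  end `|z|.

Section signals.
Context (R : realType) (s : scalar_kind) (L : normedModType (scalars R s)).
Context (ax : time_axis) (tau : {posnum R}).
Local Notation I := (time ax tau).
Local Notation mu := (mu ax tau).
Implicit Types (alpha : L -> R) (E : set (I -> L)) (F : (I -> L) -> I -> L).
Implicit Types (f g e : I -> L).

(* powR has x `^ 0 = 1 for every x, 0 included. *)
Definition delimits alpha (a b c : R) : Prop :=
  [/\ 0 <= a, 0 <= b, 0 <= c &
      forall z : L, real_norm z <= a + b * alpha z `^ c].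

Definition trunc (t : I) f : I -> L :=
  fun r => if (r : R) <= (t : R) then f r else 0.

(* Signals are classes of functions modulo mu; a set of classes is represented
   by the set of all their representatives, whence es_ae. *)
Record excitation_space alpha E : Prop := ExcitationSpace {
  es_ae : forall f g, E f -> f = g %[ae mu] -> E g;
  es_trunc : forall f t, E f -> E (trunc t f);
  es_delay : forall f, E f -> E (f \o @back R ax tau);
  es_summable : forall f (u v : R), E f ->
    mu.-integrable [set r : I | u <= (r : R) <= v] (fun r => (alpha (f r))%:E)
}.

(* F induces a map from the classes of E to the classes of E. *)
Definition operator E F : Prop :=
  (forall f, E f -> E (F f)) /\
  (forall f g, E f -> f = g %[ae mu] -> F f = F g %[ae mu]).

Definition causal E F : Prop :=
  forall f, E f -> {ae mu, forall t, F f t = F (trunc t f) t}.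

(* The integrals are taken in [0, +oo]. *)
Definition passive alpha E F : Prop :=
  forall f (t : I), E f ->
  (\int[mu]_(r in [set r : I | ((r : R) < (t : R))%R]) (alpha (F f r))%:E <=
   \int[mu]_(r in [set r : I | ((r : R) < (t : R))%R]) (alpha (f r))%:E)%E.

Definition supported_in (A : set R) e : Prop :=
  {ae mu, forall t : I, ~ A t -> e t = 0}.

(* F [e + g] (n tau) stands for F [trunc (n tau) (e + g)] (n tau), which
   presupposes that the truncation belongs to E. *)
Definition feedback E F e g : Prop :=
  {ae mu, forall t : I, (t : R) <= 0 -> g t = 0} /\
  forall n : nat, let t := tick ax tau n in
    E (trunc t (e \+ g)) /\ g (tick ax tau n.+1) = F (trunc t (e \+ g)) t.

Definition stable g : Prop :=
  exists b : R, 0 <= b /\ {ae mu, forall t, real_norm (g t) < b}.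

End signals.

(* Main.v *)
Require Import Defs.
From mathcomp Require Import all_boot all_order all_algebra.
From mathcomp Require Import finmap.
From mathcomp Require Import all_classical all_reals all_analysis.
Import Order.TTheory GRing.Theory Num.Theory.
Import numFieldNormedType.Exports.

Set Implicit Arguments.
Unset Strict Implicit.

(** Only the values of a signal at the ticks [k * tau] matter, so write
[x_k] for the value at the tick [k] of a signal [x], and [h = e + g].

Uniqueness is an induction on [n]: if two solutions agree at the ticks up to
[n], their truncated inputs are equal almost everywhere, hence so are the
outputs of [F], and a tick has positive mass.

The bound is an energy balance.  By causality, [F] applied to [h] truncated at
[n] outputs [g_(k+1)] at every tick [k] in [0, n], and passivity up to the
time [n + 1] reads
  [alpha g_1 + ... + alpha g_(n+1) <= alpha h_0 + ... + alpha h_n],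
the past contributing nothing to the right-hand side because [alpha 0 = 0]
([feedback_energy]).  The excitation is over at the tick [N], so that
[h_k = g_k] for [k >= N], and all the terms from [N] to [n] cancel.  For
[n + 1 >= N] there remains
  [alpha g_(n+1) <= sum_(k < N) (alpha h_k - alpha g_k)]
([feedback_tail]): every later value of [g] has at most the energy that was
injected before [N].  The delimiting inequality turns this bound on [alpha]
into a bound on the norm, and finitely many ticks precede [N]. *)

Local Open Scope classical_set_scope.
Local Open Scope ring_scope.

(** * Ticks and the measure they carry *)

Lemma tick_le (R : realType) (ax : time_axis) (tau : {posnum R}) (j k : int) :
  ((tick ax tau j : R) <= (tick ax tau k : R)) = (j <= k).
Proof. by rewrite /time_val /= ler_pM2r // ler_int. Qed.

Lemma tick_lt (R : realType) (ax : time_axis) (tau : {posnum R}) (j k : int) :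
  ((tick ax tau j : R) < (tick ax tau k : R)) = (j < k).
Proof. by rewrite /time_val /= ltr_pM2r // ltr_int. Qed.

Lemma tick0 (R : realType) (ax : time_axis) (tau : {posnum R}) :
  (tick ax tau 0 : R) = 0.
Proof. by rewrite /time_val /= mul0r. Qed.

Lemma tick_inj (R : realType) (ax : time_axis) (tau : {posnum R}) :
  injective (tick ax tau).
Proof.
move=> j k jk; apply/eqP; rewrite eq_le -!(tick_le ax tau) jk.
by rewrite lexx.
Qed.

Lemma mu_tick (R : realType) (ax : time_axis) (tau : {posnum R}) (k : int) :
  mu ax tau [set tick ax tau k] = tau%:num%:E.
Proof.
rewrite /mu /= /mscale /= /mrestr.
have -> : [set tick ax tau k] `&` @ticks R ax tau = [set tick ax tau k].
  by apply: setIidl => _ ->; exists k.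
rewrite /counting asboolT; last exact: finite_set1.
by rewrite fset_set1 cardfs1 mule1.
Qed.

(** A null set contains no tick, since every tick has mass [tau > 0];
conversely the complement of the ticks has mass 0. *)
Lemma ae_ticks (R : realType) (ax : time_axis) (tau : {posnum R})
    (P : time ax tau -> Prop) :
  {ae mu ax tau, forall t, P t} <-> forall k : int, P (tick ax tau k).
Proof.
split=> [[A [mA A0 PA]] k|Pk].
  apply: contrapT => nPk.
  have : (mu ax tau [set tick ax tau k] <= mu ax tau A)%E.
    by apply: le_measure; rewrite ?inE // => _ ->; exact: PA.
  by rewrite mu_tick A0 lee_fin leNgt gt0.
exists (~` @ticks R ax tau); split => //.
  by rewrite /mu /= /mscale /= /mrestr setICl measure0 mule0.
by move=> t nPt [k _ kt]; apply: nPt; rewrite -kt; exact: Pk.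
Qed.

(** Almost everywhere, [f] on [D] is a finite sum of multiples of indicators of
ticks.  Only the ticks in [s] contribute, but [D] may contain infinitely many
ticks, as the half-lines in the definition of passivity do. *)
Lemma integral_ticks (R : realType) (ax : time_axis) (tau : {posnum R})
    (D : set (time ax tau)) (f : time ax tau -> R) (s : seq int) :
  uniq s -> (forall k, k \in s -> D (tick ax tau k)) ->
  (forall k, D (tick ax tau k) -> k \notin s -> f (tick ax tau k) = 0) ->
  (\int[mu ax tau]_(r in D) (f r)%:E)%E =
    (tau%:num * \sum_(k <- s) f (tick ax tau k))%:E.
Proof.
move=> us sD f0.
pose S := \big[setU/set0]_(k <- s) [set tick ax tau k].
have SP k : S (tick ax tau k) <-> k \in s.
  rewrite /S -bigcup_seq; split=> [[j /= js /(@tick_inj R ax tau) ->] //|ks].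
  by exists k.
transitivity (\int[mu ax tau]_(r in S) (f r)%:E)%E.
  rewrite integral_mkcond [RHS]integral_mkcond.
  apply: ae_eq_integral => //; apply/ae_ticks => k _.
  rewrite !patchE; have [ks|kNs] := boolP (k \in s).
    by rewrite !mem_set //; [exact/SP|exact: sD].
  rewrite (memNset (A := S)); last by move/SP; rewrite (negbTE kNs).
  by case: ifPn => // /set_mem Dk; rewrite f0.
rewrite integral_bigsetU_EFin //; last first.
  by move=> i j _ _ [_ [/= -> /(@tick_inj R ax tau)]].
rewrite mulr_sumr -sumEFin; apply: eq_bigr => k _.
rewrite (@eq_integral _ _ _ _ _ (cst (f (tick ax tau k))%:E)).
  by rewrite integral_cst // mu_tick muleC.
by move=> t /set_mem ->.
Qed.

Lemma mem_map_Posz_iota (n : nat) (k : int) :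
  (k \in [seq Posz i | i <- index_iota 0 n]) = (0 <= k < n).
Proof.
case: k => k; last by transitivity false => //; apply/negbTE/negP => /mapP[].
by rewrite mem_map ?mem_index_iota // => i j [].
Qed.

Lemma uniq_map_Posz_iota (n : nat) : uniq [seq Posz i | i <- index_iota 0 n].
Proof. by rewrite map_inj_uniq ?iota_uniq // => i j []. Qed.

Lemma integral_ticks_from0 (R : realType) (ax : time_axis) (tau : {posnum R})
    (n : nat) (f : time ax tau -> R) :
  (\int[mu ax tau]_(r in [set r : time ax tau |
      (0 <= (r : R) < n%:R * tau%:num)%R]) (f r)%:E)%E =
    (tau%:num * \sum_(0 <= k < n) f (tick ax tau k))%:E.
Proof.
have inP (k : int) : (0 <= (tick ax tau k : R) < n%:R * tau%:num) =
    (k \in [seq Posz i | i <- index_iota 0 n]).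
  rewrite mem_map_Posz_iota -(tick0 ax tau) tick_le; congr (_ && _).
  exact: (tick_lt ax tau k n).
rewrite (integral_ticks (uniq_map_Posz_iota n)) /=.
- by rewrite big_map.
- by move=> k; rewrite inP.
- by move=> k; rewrite inP => ->.
Qed.

(** * The feedback recursion *)

Lemma trunc_trunc (R : realType) (s : scalar_kind)
    (L : normedModType (scalars R s)) (ax : time_axis) (tau : {posnum R})
    (t u : time ax tau) (f : time ax tau -> L) :
  (t : R) <= (u : R) -> trunc t (trunc u f) = trunc t f.
Proof.
move=> tu; apply: funext => r; rewrite /trunc.
by case: ifP => // rt; rewrite (le_trans rt tu).
Qed.

Lemma feedback_past (R : realType) (s : scalar_kind)
    (L : normedModType (scalars R s)) (ax : time_axis) (tau : {posnum R})
    (E : set (time ax tau -> L)) (F : (time ax tau -> L) -> time ax tau -> L)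
    (e g : time ax tau -> L) (hg : feedback E F e g) (k : int) :
  k <= 0 -> g (tick ax tau k) = 0.
Proof.
move=> k0; case: hg => /ae_ticks /(_ k) + _; apply.
by rewrite -(tick0 ax tau) tick_le.
Qed.

Lemma feedback_unique (R : realType) (s : scalar_kind)
    (L : normedModType (scalars R s)) (ax : time_axis) (tau : {posnum R})
    (E : set (time ax tau -> L)) (F : (time ax tau -> L) -> time ax tau -> L)
    (hF : operator E F) (e g g' : time ax tau -> L) :
  feedback E F e g -> feedback E F e g' -> g' = g %[ae mu ax tau].
Proof.
move=> hg hg'.
have past (k : int) : k <= 0 -> g' (tick ax tau k) = g (tick ax tau k).
  by move=> k0; rewrite (feedback_past hg) ?(feedback_past hg').
have upto (n : nat) : forall k : int, k <= n ->
    g' (tick ax tau k) = g (tick ax tau k).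
  elim: n => [|n IHn] k; first exact: past.
  rewrite le_eqVlt => /predU1P[->|]; last first.
    by rewrite -addn1 PoszD ltzD1; exact: IHn.
  have [Eg ->] := hg.2 n; have [Eg' ->] := hg'.2 n.
  suff /ae_ticks/(_ n) : F (trunc (tick ax tau n) (e \+ g')) =
      F (trunc (tick ax tau n) (e \+ g)) %[ae mu ax tau] by apply.
  apply: hF.2 => //; apply/ae_ticks => j _; rewrite /trunc tick_le.
  by case: ifP => // jn; rewrite /= IHn.
apply/ae_ticks => -[m|m] _; first exact: (upto m).
exact: past.
Qed.

(** Passivity along the loop: what [F] outputs is the next value of [g], and
what it receives is [e + g]. *)
Lemma feedback_energy (R : realType) (s : scalar_kind)
    (L : normedModType (scalars R s)) (ax : time_axis) (tau : {posnum R})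
    (alpha : L -> R) (alpha_ge0 : forall z, 0 <= alpha z)
    (alpha0 : alpha 0 = 0)
    (E : set (time ax tau -> L)) (F : (time ax tau -> L) -> time ax tau -> L)
    (F_causal : causal E F) (F_passive : passive alpha E F)
    (e g : time ax tau -> L)
    (e_past : forall k : int, k < 0 -> e (tick ax tau k) = 0)
    (hg : feedback E F e g) (n : nat) :
  \sum_(0 <= k < n) alpha (g (tick ax tau k.+1)) <=
  \sum_(0 <= k < n) alpha (e (tick ax tau k) + g (tick ax tau k)).
Proof.
case: n => [|n]; first by rewrite !big_geq.
(* The whole recursion up to [n] is read off the single input [f]. *)
set f := trunc (tick ax tau n) (e \+ g).
have [Ef _] := hg.2 n; rewrite -/f in Ef.
have Ff (k : nat) : (k <= n)%N -> F f (tick ax tau k) = g (tick ax tau k.+1).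
  move=> kn; have [_ ->] := hg.2 k.
  have /ae_ticks -> := F_causal _ Ef.
  by rewrite /f trunc_trunc // tick_le.
have fE (k : nat) : (k <= n)%N ->
    f (tick ax tau k) = e (tick ax tau k) + g (tick ax tau k).
  by move=> kn; rewrite /f /trunc tick_le lez_nat kn.
have f_past (k : int) : k < 0 -> f (tick ax tau k) = 0.
  move=> k0; rewrite /f /trunc; case: ifP => //= _.
  by rewrite e_past // (feedback_past hg (ltW k0)) addr0.
pose past := [set r : time ax tau | (r : R) < (tick ax tau n.+1 : R)].
pose recent := [set r : time ax tau | 0 <= (r : R) < n.+1%:R * tau%:num].
have pastP (k : int) : past (tick ax tau k) = (k < n.+1).
  by rewrite /past /= tick_lt.
have energy_out : (\int[mu ax tau]_(r in recent) (alpha (F f r))%:E)%E =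
    (tau%:num * \sum_(0 <= k < n.+1) alpha (g (tick ax tau k.+1)))%:E.
  rewrite (integral_ticks_from0 n.+1 (alpha \o F f)) /=.
  by congr (_ * _)%:E; apply: eq_big_nat => k /andP[_ kn]; rewrite Ff.
have energy_in : (\int[mu ax tau]_(r in past) (alpha (f r))%:E)%E =
    (tau%:num * \sum_(0 <= k < n.+1)
      alpha (e (tick ax tau k) + g (tick ax tau k)))%:E.
  rewrite (@integral_ticks _ _ _ _ (alpha \o f) _ (uniq_map_Posz_iota n.+1)).
  - congr (_ * _)%:E; rewrite big_map /=; apply: eq_big_nat => k /andP[_ kn].
    by rewrite fE.
  - by move=> k; rewrite mem_map_Posz_iota pastP => /andP[].
  - move=> k; rewrite pastP mem_map_Posz_iota => ->; rewrite andbT -ltNge => k0.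
    by rewrite /= f_past.
(* [F f] need not vanish in the past, where the recursion says nothing about
   it; as [alpha] is non-negative, its past energy is simply dropped. *)
rewrite -(ler_pM2l (gt0 tau)) -lee_fin -energy_in -energy_out.
apply: le_trans (F_passive f (tick ax tau n.+1) Ef).
apply: ge0_subset_integral => //.
  by move=> r _; rewrite lee_fin.
by move=> r /andP[].
Qed.

(** The two sides of the energy balance are shifted by one tick, and after the
end of the excitation they have all terms but the last in common. *)
Lemma feedback_tail (R : realType) (s : scalar_kind)
    (L : normedModType (scalars R s)) (ax : time_axis) (tau : {posnum R})
    (alpha : L -> R) (alpha_ge0 : forall z, 0 <= alpha z)
    (alpha0 : alpha 0 = 0)
    (E : set (time ax tau -> L)) (F : (time ax tau -> L) -> time ax tau -> L)
    (F_causal : causal E F) (F_passive : passive alpha E F)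
    (N : nat) (e g : time ax tau -> L)
    (e_supp : supported_in [set r | 0 <= r < N%:R * tau%:num] e)
    (hg : feedback E F e g) (m : nat) :
  (N <= m)%N ->
  alpha (g (tick ax tau m)) <= \sum_(0 <= k < N)
    (alpha (e (tick ax tau k) + g (tick ax tau k)) - alpha (g (tick ax tau k))).
Proof.
move=> Nm.
have e0 (k : int) : ~ (0 <= k < N) -> e (tick ax tau k) = 0.
  move=> kN; move/ae_ticks: e_supp; apply => /= /andP[].
  rewrite pmulr_lge0 // ler0z => k0.
  rewrite /time_val /= ltr_pM2r // pmulrn ltr_int => kltN.
  by apply: kN; apply/andP.
have e_past (k : int) : k < 0 -> e (tick ax tau k) = 0.
  by move=> k0; apply: e0 => /andP[]; rewrite leNgt k0.
have := feedback_energy alpha_ge0 alpha0 F_causal F_passive e_past hg m.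
pose x k := alpha (g (tick ax tau (Posz k))).
(* The shift is harmless at its lower end because [g] is 0 at time 0. *)
have -> : \sum_(0 <= k < m) alpha (g (tick ax tau k.+1)) =
    x m + \sum_(0 <= k < m) x k.
  rewrite [RHS]addrC -big_nat_recr //= big_nat_recl //= {1}/x.
  by rewrite (feedback_past hg) // alpha0 add0r.
rewrite -lerBrDr -sumrB (big_cat_nat (n := N)) //=.
rewrite [X in _ <= _ + X -> _]big_nat_cond [X in _ <= _ + X -> _]big1 ?addr0 //.
move=> k /andP[/andP[Nk _] _]; rewrite e0 ?add0r ?subrr //.
by move=> /andP[_]; rewrite ltz_nat ltnNge Nk.
Qed.

(** * Bound and stability *)

Lemma stable_eventually_bounded (R : realType) (s : scalar_kind)
    (L : normedModType (scalars R s)) (ax : time_axis) (tau : {posnum R})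
    (g : time ax tau -> L) (N : nat) (B : R) :
  (forall k : int, k <= 0 -> g (tick ax tau k) = 0) ->
  (forall m : nat, (N <= m)%N -> real_norm (g (tick ax tau m)) <= B) ->
  stable g.
Proof.
move=> past tail.
pose C := `|real_norm (0 : L)| + `|B| +
  \sum_(k < N) `|real_norm (g (tick ax tau k))|.
have S0 : 0 <= \sum_(k < N) `|real_norm (g (tick ax tau k))| by exact: sumr_ge0.
(* The definition of stability asks for a strict inequality, whence the 1. *)
exists (C + 1); split; first by rewrite !addr_ge0.
apply/ae_ticks => k; rewrite ltr_pwDr //.
have [k0|] := leP k 0.
  rewrite past //; apply: le_trans (ler_norm _) _.
  by rewrite /C -addrA lerDl addr_ge0.
case: k => // m _; have [Nm|mN] := leqP N m.
  apply: le_trans (tail _ Nm) _; apply: le_trans (ler_norm _) _.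
  by rewrite /C addrAC lerDr addr_ge0.
apply: le_trans (ler_norm _) _; rewrite /C (bigD1 (Ordinal mN)) //= addrCA.
by rewrite lerDl !addr_ge0 // sumr_ge0.
Qed.

(* alpha0 is needed: if alpha 0 > 0, both integrals in the definition of
   passive are +oo for every signal that vanishes in the past, and the bound
   fails.  The factor b stands outside the power, as in delimits: with
   (b / tau * \int ...) `^ c the bound fails, e.g. for F = id on R,
   alpha z = z ^ 2 / 4 and (a, b, c) = (0, 2, 1 / 2). *)
Theorem theorem2p1 (R : realType) (s : scalar_kind)
    (L : normedModType (scalars R s)) (ax : time_axis) (tau : {posnum R})
    (alpha : L -> R)
    (alpha_cont : continuous alpha) (alpha_ge0 : forall z, 0 <= alpha z)
    (alpha0 : alpha 0 = 0)
    (alpha_delim : exists a b c : R, delimits alpha a b c)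
    (E : set (time ax tau -> L)) (hE : excitation_space alpha E)
    (F : (time ax tau -> L) -> time ax tau -> L)
    (hF : operator E F) (F_causal : causal E F) (F_passive : passive alpha E F)
    (N : nat) (N_ge1 : (1 <= N)%N)
    (e : time ax tau -> L) (Ee : E e)
    (e_supp : supported_in [set r | 0 <= r < N%:R * tau%:num] e)
    (g : time ax tau -> L) (hg : feedback E F e g) :
  [/\ (forall g', feedback E F e g' -> g' = g %[ae mu ax tau]),
      (forall a b c : R, delimits alpha a b c ->
        {ae mu ax tau, forall t : time ax tau, N%:R * tau%:num <= (t : R) ->
          real_norm (g t) <=
            a + b * (tau%:num^-1 *
              \int[mu ax tau]_(r in [set r : time ax tau |
                                      0 <= (r : R) < N%:R * tau%:num])
                (alpha (e r + g r) - alpha (g r))) `^ c}) &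
      stable g].
Proof.
have rangeN (k : int) : (N%:R * tau%:num <= (tick ax tau k : R)) = (N%:Z <= k).
  by rewrite -(tick_le ax tau).
have bound (a b c : R) (habc : delimits alpha a b c) (m : nat) :
    (N <= m)%N ->
    real_norm (g (tick ax tau m)) <= a + b * (\sum_(0 <= k < N)
      (alpha (e (tick ax tau k) + g (tick ax tau k)) -
       alpha (g (tick ax tau k)))) `^ c.
  move=> Nm; case: habc => _ b0 c0 h; apply: le_trans (h _) _; rewrite lerD2l.
  have tail := feedback_tail alpha_ge0 alpha0 F_causal F_passive e_supp hg Nm.
  apply: ler_wpM2l => //; apply: ge0_ler_powR; rewrite ?nnegrE //.
  exact: le_trans tail.
split.
- by move=> g' hg'; exact (feedback_unique hF hg hg').
- move=> a b c habc.
  rewrite /Rintegral (integral_ticks_from0 N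
    (fun r => alpha (e r + g r) - alpha (g r))) /= mulKf //.
  apply/ae_ticks => -[m|m]; rewrite rangeN //.
  exact: bound.
case: alpha_delim => a [b [c habc]].
have past (k : int) : k <= 0 -> g (tick ax tau k) = 0.
  by move=> k0; exact: (feedback_past hg k0).
exact (stable_eventually_bounded past (bound a b c habc)).
Qed.
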